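(* Let $n\ge1$. There is a constant $C_n$ depending only on $n$ such that for every fixed $\omega\in S^{n-1}$ and every $f\in L^1(G_n)$, $$\|\mathcal M_{\gamma_\omega}^{\mathrm{tail}}f\|_{L^1(G_n)}\le C_n\|f\|_{L^1(G_n)}.$$ Consequently, $$\|\mathcal M_{\gamma_\omega}^{\mathrm{tail}}f\|_{L^{1,\infty}(G_n)}\le C_n\|f\|_{L^1(G_n)}.$$
   Context: $G_n=\mathbb R^n\times(0,\infty)$ is equipped with the measure $d\mu(x,y)=\frac{dx\,dy}{y^{n+1}}$ (the left Haar measure for the group law $(x,y)(x',y')=(x+yx',yy')$); $L^p(G_n)$ and $L^{1,\infty}(G_n)$ are taken with respect to $\mu$, with $\|g\|_{L^{1,\infty}(G_n)}=\sup_{\lambda>0}\lambda\,\mu\{|g|>\lambda\}$. For $\omega$ in the unit sphere $S^{n-1}\subset\mathbb R^n$, $$\mathcal M_{\gamma_\omega}^{\mathrm{tail}}f(x,y)=\sup_{r\ge1}\frac1r\int_0^r|f(x+y\omega\tanh t,\,y\operatorname{sech}t)|\,dt .$$ *)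

(* Defs.v *)
(* MathComp-Analysis; [R : realType] is the field of real numbers. *)
From HB Require Import structures.
From mathcomp Require Import all_boot all_order all_algebra.
From mathcomp Require Import all_classical all_reals all_analysis.
From mathcomp Require Import measurable_realfun.
Import Order.TTheory GRing.Theory Num.Theory.
Import numFieldNormedType.Exports.

Set Implicit Arguments.
Unset Strict Implicit.
Unset Printing Implicit Defensive.

Local Open Scope classical_set_scope.
Local Open Scope ring_scope.

(* The library's Lebesgue measure lives on [measurableTypeR R], whose sigma-algebra
   is convertible to that of R but has another display; this copy lives on R, so
   that products with R carry a single measurable structure. *)
Definition lebesgueR (R : realType) : set R -> \bar R := lebesgue_measure.
Arguments lebesgueR R : clear implicits.

Section lebesgueR_measure.
Context (R : realType).

Let lebesgueR0 : lebesgueR R set0 = 0%E.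
Proof. exact: (measure0 (@lebesgue_measure R)). Qed.

Let lebesgueR_ge0 A : (0 <= lebesgueR R A)%E.
Proof. exact: (measure_ge0 (@lebesgue_measure R)). Qed.

Let lebesgueR_sigma_additive : semi_sigma_additive (lebesgueR R).
Proof. exact (@measure_semi_sigma_additive _ _ _ (@lebesgue_measure R)). Qed.

HB.instance Definition _ := isMeasure.Build _ _ _ (lebesgueR R)
  lebesgueR0 lebesgueR_ge0 lebesgueR_sigma_additive.

Let lebesgueR_sigma_finite : sigma_finite setT (lebesgueR R).
Proof. exact (sigma_finiteT (@lebesgue_measure R)). Qed.

HB.instance Definition _ := Measure_isSigmaFinite.Build _ _ _ (lebesgueR R)
  lebesgueR_sigma_finite.

End lebesgueR_measure.

Definition cons_pair (T : Type) n (u : T * n.-tuple T) : n.+1.-tuple T :=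
  [tuple of u.1 :: u.2].

(* Lebesgue measure on R^n as the n-fold product of Lebesgue measure on R. R^n
   is the type [n.-tuple R] with its product sigma-algebra, i.e. the Borel
   sets of R^n. *)
Fixpoint lebesgue_tuple (R : realType) n : set (n.-tuple R) -> \bar R :=
  match n with
  | 0%N => dirac [tuple]
  | m.+1 => pushforward (lebesgueR R \x @lebesgue_tuple R m)%E
                        (@cons_pair R m)
  end.
Arguments lebesgue_tuple R n : clear implicits.

Section cons_measure.
Context (R : realType) (n : nat).
Variable m : {sigma_finite_measure set (n.-tuple R) -> \bar R}.
Local Open Scope ereal_scope.

Let prod := [the {measure set _ -> \bar R} of lebesgueR R \x m].

Let cons_measure := pushforward prod (@cons_pair R n).

Let measurable_cons_pair : measurable_fun setT (@cons_pair R n).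
Proof. exact: measurable_cons. Qed.

Let cons0 : cons_measure set0 = 0.
Proof. by rewrite /cons_measure /pushforward preimage_set0 measure0. Qed.

Let cons_ge0 A : 0 <= cons_measure A.
Proof. exact: integral_ge0. Qed.

Let cons_sigma_additive : semi_sigma_additive cons_measure.
Proof.
move=> F mF tF mUF; rewrite /cons_measure /pushforward preimage_bigcup.
apply: measure_semi_sigma_additive.
- by move=> k; rewrite -[X in measurable X]setTI; exact: measurable_cons_pair.
- apply/trivIsetP => /= i j _ _ ij; rewrite -preimage_setI.
  by move/trivIsetP : tF => /(_ _ _ _ _ ij) ->//; rewrite preimage_set0.
- rewrite -preimage_bigcup -[X in measurable X]setTI.
  exact: measurable_cons_pair.
Qed.

HB.instance Definition _ := isMeasure.Build _ _ _ cons_measure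
  cons0 cons_ge0 cons_sigma_additive.

Let cons_sigma_finite : sigma_finite setT cons_measure.
Proof.
have /sigma_finiteP[F [UF ndF Foo]] := sigma_finiteT (lebesgueR R).
have /sigma_finiteP[G [UG ndG Goo]] := sigma_finiteT m.
pose g (v : n.+1.-tuple R) := (thead v, [tuple of behead v]).
have mg : measurable_fun setT g.
  apply/measurable_fun_pairP; split; first exact: measurable_tnth.
  exact: measurable_behead.
have gK : cancel (@cons_pair R n) g.
  by move=> [x v]; rewrite /g /cons_pair theadE; congr pair; exact/val_inj.
exists (fun k => g @^-1` (F k `*` G k)).
  apply/esym/seteqP; split => // v _.
  have : (\bigcup_k F k) (g v).1 by rewrite -UF.
  have : (\bigcup_k G k) (g v).2 by rewrite -UG.
  move=> [j _ Gj] [i _ Fi]; exists (maxn i j) => //; split.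
  - by move: (g v).1 Fi; exact/subsetPset/ndF/leq_maxl.
  - by move: (g v).2 Gj; exact/subsetPset/ndG/leq_maxr.
move=> k; have [mF Fk] := Foo k; have [mG Gk] := Goo k; split.
  by rewrite -[X in measurable X]setTI; apply: mg => //; exact: measurableX.
rewrite /cons_measure /pushforward (_ : _ @^-1` _ = F k `*` G k); last first.
  by rewrite -comp_preimage (_ : _ \o _ = id)//; exact/funext.
by rewrite /= product_measure1E// lte_mul_pinfty// ge0_fin_numE.
Qed.

HB.instance Definition _ := Measure_isSigmaFinite.Build _ _ _ cons_measure
  cons_sigma_finite.

Lemma cons_measureP :
  exists m' : {sigma_finite_measure set (n.+1.-tuple R) -> \bar R},
    m' = cons_measure :> (set _ -> \bar R).
Proof. by exists cons_measure. Qed.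

End cons_measure.

Section lebesgue_tuple_measure.
Context (R : realType) (n : nat).
Local Notation mu := (lebesgue_tuple R n).

Lemma lebesgue_tupleP :
  exists m : {sigma_finite_measure set (n.-tuple R) -> \bar R},
    m = mu :> (set _ -> \bar R).
Proof.
elim: n => [|k [m mE]]; first by exists (dirac [tuple]).
have [m' m'E] := cons_measureP m; exists m'.
by rewrite m'E /= mE.
Qed.

Let lebesgue_tuple0 : mu set0 = 0%E.
Proof. by have [m <-] := lebesgue_tupleP; exact: measure0. Qed.

Let lebesgue_tuple_ge0 A : (0 <= mu A)%E.
Proof. by have [m <-] := lebesgue_tupleP; exact: measure_ge0. Qed.

Let lebesgue_tuple_sigma_additive : semi_sigma_additive mu.
Proof.
by have [m <-] := lebesgue_tupleP; exact: measure_semi_sigma_additive.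
Qed.

HB.instance Definition _ := isMeasure.Build _ _ _ mu
  lebesgue_tuple0 lebesgue_tuple_ge0 lebesgue_tuple_sigma_additive.

Let lebesgue_tuple_sigma_finite : sigma_finite setT mu.
Proof. by have [m <-] := lebesgue_tupleP; exact: sigma_finiteT. Qed.

HB.instance Definition _ := Measure_isSigmaFinite.Build _ _ _ mu
  lebesgue_tuple_sigma_finite.

End lebesgue_tuple_measure.

(* G_n = R^n x (0, +oo), as a subset of R^n x R: a function on G_n is a
   function on R^n x R of which only the values on [halfspace R n] matter. *)
Definition halfspace (R : realType) n : set (n.-tuple R * R) :=
  [set z | 0 < z.2].
Arguments halfspace R n : clear implicits.

(* d mu(x, y) = dx dy / y^(n+1) on G_n; the complement of G_n is null. *)
Definition haar (R : realType) n (A : set (n.-tuple R * R)) : \bar R :=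
  (\int[lebesgue_tuple R n \x lebesgueR R]_(z in A `&` halfspace R n)
     (z.2 ^- n.+1)%:E)%E.
Arguments haar R n : clear implicits.

Section haar_measure.
Context (R : realType) (n : nat).
Local Open Scope ereal_scope.

Lemma measurable_halfspace : measurable (halfspace R n).
Proof.
rewrite (_ : halfspace R n = setT `&` snd @^-1` `]0%R, +oo[).
  exact: measurable_snd.
by apply/seteqP; split => z /=; rewrite in_itv/= andbT// => -[].
Qed.

Lemma measurable_haar_density :
  measurable_fun (halfspace R n)
    (fun z : n.-tuple R * R => (z.2 ^- n.+1)%:E).
Proof.
apply/measurable_EFinP.
apply: (@eq_measurable_fun _ _ _ _ _
    (fun z : n.-tuple R * R => powR z.2 (- n.+1%:R))).
  move=> z; rewrite inE /halfspace/= => z0.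
  by rewrite powRN powR_mulrn// ltW.
apply: measurable_funTS => /=.
exact: (measurableT_comp (measurable_powR _) measurable_snd).
Qed.

Let haar0 : haar R n set0 = 0.
Proof. by rewrite /haar set0I integral_set0. Qed.

Let haar_ge0 A : 0 <= haar R n A.
Proof.
apply: integral_ge0 => z [_]; rewrite /halfspace/= => z0.
by rewrite lee_fin invr_ge0 exprn_ge0// ltW.
Qed.

Let haar_sigma_additive : semi_sigma_additive (haar R n).
Proof.
move=> F mF tF mUF; rewrite /haar setI_bigcupl.
rewrite ge0_integral_bigcup//=.
- by apply: is_cvg_ereal_nneg_natsum_cond => k _ _; exact: haar_ge0.
- by move=> k; apply: measurableI => //; exact: measurable_halfspace.
- apply: measurable_funS measurable_haar_density.
    exact: measurable_halfspace.
  by apply: bigcup_sub => k _ z [].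
- move=> z [k _ [_]]; rewrite /halfspace/= => z0.
  by rewrite lee_fin invr_ge0 exprn_ge0// ltW.
- exact: trivIset_setIr.
Qed.

HB.instance Definition _ := isMeasure.Build _ _ _ (haar R n)
  haar0 haar_ge0 haar_sigma_additive.

End haar_measure.

Section tail_maximal.
Context {R : realType}.
Implicit Type t : R.

Definition tanh t : R := (expR t - expR (- t)) / (expR t + expR (- t)).

Definition sech t : R := 2 / (expR t + expR (- t)).

(* The library's norm on vectors is the sup norm, so the Euclidean unit sphere
   is spelled out. *)
Definition unit_sphere n : set (n.-tuple R) :=
  [set w | \sum_(i < n) tnth w i ^+ 2 = 1].

Definition gamma_path n (w : n.-tuple R) (z : n.-tuple R * R) t :
    n.-tuple R * R :=
  ([tuple tnth z.1 i + z.2 * tnth w i * tanh t | i < n], z.2 * sech t).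

Local Open Scope ereal_scope.

Definition tail_maximal n (w : n.-tuple R) (f : n.-tuple R * R -> \bar R)
    (z : n.-tuple R * R) : \bar R :=
  ereal_sup [set (r^-1)%:E *
      \int[lebesgue_measure]_(t in `[0%R, r]) `|f (gamma_path w z t)|
    | r in [set r : R | (1 <= r)%R]].

(* The quasi-norm of L^{1,oo} of a domain D. *)
Definition weak_L1_norm d (T : measurableType d) (mu : set T -> \bar R)
    (D : set T) (g : T -> \bar R) : \bar R :=
  ereal_sup [set l%:E * mu (D `&` [set z | l%:E < `|g z|])
    | l in [set l : R | (0 < l)%R]].

End tail_maximal.
Arguments unit_sphere R n : clear implicits.

(* Main.v *)
From HB Require Import structures.
Require Import Defs.
From mathcomp Require Import all_boot all_order all_algebra.
From mathcomp Require Import all_classical all_reals all_analysis.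
From mathcomp Require Import measurable_realfun.
From mathcomp Require Import ring lra.
Import Order.TTheory GRing.Theory Num.Theory.
Import numFieldNormedType.Exports.
Local Open Scope classical_set_scope.
Local Open Scope ring_scope.

Set Implicit Arguments.
Unset Strict Implicit.
Unset Printing Implicit Defensive.

(** Why the bound holds, with the constant [2].

    For [r >= 1] the factor [r^-1] is at most [1], so the tail maximal function
    at [z] is at most the integral of [|f|] along the whole path
    [t |-> gamma_path w z t] with [t >= 0] ([tail_maximal_le]). This path is [z]
    multiplied on the right, in the group [G_n], by [(w tanh t, sech t)]
    ([gamma_pathE]), and right multiplication by [(a, b)] multiplies integrals
    against the left Haar measure by [b ^+ n] ([ge0_integral_haar_right_mul]).
    Tonelli therefore bounds the [L^1] norm of the maximal function by
    [\int_0^oo sech t ^+ n dt] times that of [f]. As [n >= 1], this integral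
    converges, and it is at most [\int_0^oo 2 * expR (- t) dt = 2]
    ([integral_sech_le2]). Only the curve's last coordinate enters the
    bound, whence the uniformity in [w]. The weak-type bound is Markov's
    inequality ([weak_L1_norm_le]).

    What this leaves is measure theory. The modular function of [G_n] comes from
    translation invariance in [R^n] and the substitution [y * b] on the line,
    applied to the density of Haar measure ([ge0_integral_density]); the same
    density gives Tonelli for Haar measure ([haar_tonelli]). The maximal
    function is measurable since the supremum over real [r >= 1] may be taken
    over rational [r] ([ereal_sup_ge1_esups]). *)

(** * Changes of variables for Lebesgue measure *)

(** The two sides carry sigma-algebras on the reals that agree but live under
    different displays; the identity, seen as a measurable map between them,
    transports the integral. *)
Lemma ge0_integral_lebesgueR (R : realType) (D : set R) (f : R -> \bar R) :
  measurable D -> measurable_fun D f -> (forall x, D x -> 0 <= f x)%E ->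
  (\int[lebesgue_measure]_(x in D) f x = \int[lebesgueR R]_(x in D) f x)%E.
Proof.
move=> mD mf f0.
pose phi : R -> measurableTypeR R := id.
have mphi : measurable_fun setT phi by move=> _ B mB; rewrite setTI; exact: mB.
have := @ge0_integral_pushforward _ _ R (measurableTypeR R) R phi mphi
  (lebesgueR R) D f mD mf.
by apply => y /[!inE] /f0.
Qed.

(** By uniqueness of Lebesgue measure, [b] times the image of Lebesgue measure
    under [x |-> b * x + a] is Lebesgue measure, as both give an interval its
    length; the formula is then the image-measure formula. *)
Lemma ge0_integral_affine (R : realType) (a b : R) (g : R -> \bar R) :
  (0 < b)%R -> measurable_fun setT g -> (forall x, 0 <= g x)%E ->
  (\int[lebesgueR R]_x g (b * x + a)%R = b^-1%:E * \int[lebesgueR R]_x g x)%E.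
Proof.
move=> b0 mg g0.
pose phi (x : R) : R := b * x + a.
have mphi : measurable_fun setT phi.
  by apply: measurable_funD => //; exact: measurable_funM.
(* [psi] is [phi] landing in the copy of the reals on which uniqueness of
   Lebesgue measure is stated. *)
pose psi : R -> measurableTypeR R := phi.
have mpsi : measurable_fun setT psi by exact: mphi.
pose bl : {measure set R -> \bar R} := mscale (NngNum (ltW b0)) (lebesgueR R).
(* The measure structures on the images are given by name: inference on a
   [pushforward] selects the one special to [cons_pair]. *)
pose nu : {measure set (measurableTypeR R) -> \bar R} :=
  measure_function_pushforward__canonical__measure_function_Measure bl mpsi.
have E (A : set (measurableTypeR R)) :
    measurable A -> lebesgue_measure A = nu A.
  apply: lebesgue_measure_unique => //= _ [[c d] _ <-].
  rewrite /nu /= /pushforward /bl /mscale /=.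
  have -> : psi @^-1` `]c, d] = `](c - a) / b, (d - a) / b]%classic.
    apply/seteqP; split => x /=; rewrite /psi /phi !in_itv/=;
      by rewrite ltr_pdivrMr// ler_pdivlMr// ltrBlDr lerBrDr (mulrC b).
  rewrite [X in (_ * X)%E](_ : _ =
    lebesgue_measure `](c - a) / b, (d - a) / b])//.
  rewrite !lebesgue_measure_itv/= !lte_fin ltr_pM2r ?invr_gt0// ltrD2r.
  case: ifPn => cd; last by rewrite mule0.
  by rewrite -!EFinD -EFinM; congr EFin; field; rewrite gt_eqF.
pose nuR : {measure set R -> \bar R} :=
  measure_function_pushforward__canonical__measure_function_Measure bl mphi.
have -> : (\int[lebesgueR R]_x g x = \int[nuR]_x g x)%E.
  by apply: eq_measure_integral => A mA _; exact: E.
rewrite ge0_integral_pushforward// preimage_setT.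
rewrite ge0_integral_mscale//=; last first.
  exact: measurableT_comp.
by rewrite muleA -EFinM mulVf ?gt_eqF// mul1e.
Qed.

Lemma measurable_cons_pair (R : realType) n :
  measurable_fun setT (@cons_pair R n).
Proof. exact: measurable_cons. Qed.

Definition translate (R : realType) n (v x : n.-tuple R) : n.-tuple R :=
  [tuple tnth x i + tnth v i | i < n].

Lemma measurable_translate (R : realType) n (v : n.-tuple R) :
  measurable_fun setT (translate v).
Proof.
apply/measurable_fun_tnthP => i.
rewrite (_ : _ \o _ = fun x => tnth x i + tnth v i); last first.
  by apply/funext => x /=; rewrite tnth_mktuple.
by apply: measurable_funD => //; exact: measurable_tnth.
Qed.

Lemma translate_cons_pair (R : realType) n (a x : R) (v u : n.-tuple R) :
  translate (cons_pair (a, v)) (cons_pair (x, u)) =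
  cons_pair (x + a, translate v u).
Proof.
apply: eq_from_tnth => i; rewrite tnth_mktuple.
case: (unliftP ord0 i) => [j ->|->].
  by rewrite !tnthS tnth_mktuple.
by rewrite !tnth0.
Qed.

Lemma ge0_integral_lebesgue_tupleS (R : realType) n
    (g : n.+1.-tuple R -> \bar R) :
  measurable_fun setT g -> (forall x, 0 <= g x)%E ->
  (\int[lebesgue_tuple R n.+1]_x g x =
   \int[lebesgueR R]_x \int[lebesgue_tuple R n]_u g (cons_pair (x, u)))%E.
Proof.
move=> mg g0.
rewrite [LHS](_ : _ = \int[pushforward (lebesgueR R \x lebesgue_tuple R n)%E
  (@cons_pair R n)]_x g x)%E//.
rewrite (ge0_integral_pushforward (@measurable_cons_pair R n))//.
rewrite preimage_setT fubini_tonelli1//; last by move=> x; exact: g0.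
by apply: (measurableT_comp mg); exact: measurable_cons_pair.
Qed.

(** Induction on the dimension: Tonelli splits off the first coordinate, where
    invariance is the case of slope [1] of the affine change of variables. *)
Lemma ge0_integral_translate (R : realType) n (v : n.-tuple R)
    (g : n.-tuple R -> \bar R) :
  measurable_fun setT g -> (forall x, 0 <= g x)%E ->
  (\int[lebesgue_tuple R n]_x g (translate v x) =
   \int[lebesgue_tuple R n]_x g x)%E.
Proof.
elim: n v g => [|n IH] v g mg g0.
  by apply: eq_integral => x _; rewrite (tuple0 (translate v x)) (tuple0 x).
have mgv : measurable_fun setT (g \o translate v).
  by apply: (measurableT_comp mg); exact: measurable_translate.
rewrite !ge0_integral_lebesgue_tupleS//.
have -> : v = cons_pair (thead v, [tuple of behead v]).
  by rewrite [LHS]tuple_eta; exact: val_inj.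
move: (thead v) [tuple of behead v] => a w.
have mgc : measurable_fun setT (g \o @cons_pair R n).
  by apply: (measurableT_comp mg); exact: measurable_cons_pair.
have mgx x : measurable_fun setT (fun u => g (cons_pair (x, u))).
  exact: (measurable_fun_pair2 x mgc).
under eq_integral => x _.
  under eq_integral do rewrite translate_cons_pair.
  rewrite (IH w (fun u => g (cons_pair (x + a, u))))//.
  over.
have := @ge0_integral_affine R a 1
  (fun x => \int[lebesgue_tuple R n]_u g (cons_pair (x, u)))%E ltr01.
rewrite invr1 mul1e => <-.
- by under [in RHS]eq_integral do rewrite mul1r.
- apply: (measurable_fun_fubini_tonelli_F (g \o @cons_pair R n)) => //.
  by move=> x; exact: g0.
- by move=> x; exact: integral_ge0.
Qed.

(** * Measures with a density *)

Section density.
Local Open Scope ereal_scope.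
Context d (T : measurableType d) (R : realType).
Variables (m nu : {measure set T -> \bar R}) (D : set T) (h : T -> R).
Hypothesis mD : measurable D.
Hypothesis mh : measurable_fun D h.
Hypothesis h0 : forall x, D x -> (0 <= h x)%R.
Hypothesis nuE :
  forall A, measurable A -> nu A = \int[m]_(x in A `&` D) (h x)%:E.

Import HBNNSimple.

(** Both sides are continuous along increasing sequences of functions and
    linear, so the definition of [nu], which is the case of an indicator,
    extends to simple functions and from there to every nonnegative [f]. *)
Lemma ge0_integral_density (f : T -> \bar R) :
  measurable_fun D f -> (forall x, D x -> 0 <= f x) ->
  \int[nu]_(x in D) f x = \int[m]_(x in D) (f x * (h x)%:E).
Proof.
move=> mf f0; pose f_ := nnsfun_approx mD mf.
transitivity (limn (fun n => \int[nu]_(x in D) (f_ n x)%:E)).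
  rewrite -monotone_convergence//=.
  - apply: eq_integral => x /[!inE] xD; apply/esym/cvg_lim => //=.
    exact: cvg_nnsfun_approx.
  - by move=> n; apply/measurable_EFinP/measurable_funTS.
  - by move=> n x _; rewrite lee_fin.
  - by move=> x _ a b ab; rewrite lee_fin//; exact/lefP/nd_nnsfun_approx.
transitivity
    (limn (fun n => \int[m]_(x in D) ((f_ n x)%:E * (h x)%:E))); last first.
  rewrite -monotone_convergence//=.
  - apply: eq_integral => x /[!inE] xD; apply/cvg_lim => //=.
    by apply: cvgeZr => //; exact: cvg_nnsfun_approx.
  - move=> n; apply: emeasurable_funM; last exact/measurable_EFinP.
    exact/measurable_EFinP/measurable_funTS.
  - by move=> n x Dx; rewrite mule_ge0 ?lee_fin ?h0.
  - move=> x Dx a b ab; rewrite lee_wpmul2r ?lee_fin ?h0//.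
    exact/lefP/nd_nnsfun_approx.
congr (limn _); apply/funext => n.
transitivity (\sum_(k \in range (f_ n))
    \int[nu]_(x in D) (k * \1_(f_ n @^-1` [set k]) x)%:E).
  under eq_integral do rewrite fimfunE -fsumEFin//.
  rewrite ge0_integral_fsum//.
  - by move=> r; exact/measurable_EFinP/measurableT_comp.
  - by move=> r x _; rewrite EFinM nnfun_muleindic_ge0.
transitivity (\sum_(k \in range (f_ n))
    \int[m]_(x in D) ((k * \1_(f_ n @^-1` [set k]) x)%:E * (h x)%:E)); last first.
  under [RHS]eq_integral => x xD.
    rewrite fimfunE -fsumEFin// ge0_mule_fsuml; last first.
      by move=> r; rewrite EFinM nnfun_muleindic_ge0.
    over.
  rewrite ge0_integral_fsum//.
  - move=> r; apply: emeasurable_funM; last exact/measurable_EFinP.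
    exact/measurable_EFinP/measurableT_comp.
  - move=> r x Dx; rewrite mule_ge0 ?lee_fin ?h0//.
    by have := nnfun_muleindic_ge0 (f_ n) r x; rewrite -EFinM lee_fin.
apply: eq_fsbigr => r /[!inE] -[x0 _ rE].
have r0 : (0 <= r)%R by rewrite -rE.
set E := f_ n @^-1` [set r].
have mE : measurable E by exact: measurable_sfunP.
rewrite integralZl_indic_nnsfun// integral_indic// nuE; last exact: measurableI.
under [RHS]eq_integral do rewrite EFinM -muleA.
rewrite ge0_integralZl//; last first.
- by move=> x Dx; rewrite mule_ge0 ?lee_fin ?h0.
- apply: emeasurable_funM; last exact/measurable_EFinP.
  exact/measurable_EFinP/measurable_indic.
congr (_ * _).
rewrite -setIA setIid setIC integral_mkcondr; apply: eq_integral => x _.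
by rewrite /E patchE indicE; case: ifP; rewrite ?mul1e ?mul0e.
Qed.
End density.

(** Tonelli for [nu] without sigma-finiteness of [nu] itself: writing [nu] as a
    density with respect to [m] moves the exchange to [m] and [m2]. *)
Lemma density_tonelli d1 d2 (T1 : measurableType d1)
    (T2 : measurableType d2) (R : realType)
    (m : {sigma_finite_measure set T1 -> \bar R})
    (nu : {measure set T1 -> \bar R})
    (m2 : {sigma_finite_measure set T2 -> \bar R})
    (D : set T1) (h : T1 -> R) (F : T1 * T2 -> \bar R) :
  measurable D -> measurable_fun D h -> (forall x, D x -> 0 <= h x) ->
  (forall A, measurable A -> nu A = \int[m]_(x in A `&` D) (h x)%:E)%E ->
  measurable_fun setT F -> (forall z, 0 <= F z)%E ->
  (\int[nu]_(x in D) \int[m2]_y F (x, y) =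
   \int[m2]_y \int[nu]_(x in D) F (x, y))%E.
Proof.
move=> mD mh h0 nuE mF F0.
pose k := h \_ D.
have mk : measurable_fun setT k by exact/(measurable_restrictT _ mD).
have k0 x : 0 <= k x by rewrite /k patchE; case: ifPn => // /[!inE] /h0.
have nu_k (f : T1 -> \bar R) :
    measurable_fun setT f -> (forall x, 0 <= f x)%E ->
    (\int[nu]_(x in D) f x = \int[m]_x (f x * (k x)%:E))%E.
  move=> mf f0; rewrite (ge0_integral_density mD mh h0 nuE)//; last first.
    exact: measurable_funTS.
  rewrite integral_mkcond; apply: eq_integral => x _.
  by rewrite /k !patchE; case: ifP; rewrite ?mule0.
have mFk : measurable_fun setT (fun u => F u * (k u.1)%:E)%E.
  apply: emeasurable_funM => //; apply/measurable_EFinP.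
  exact: measurableT_comp.
rewrite nu_k; last 2 first.
- exact: (measurable_fun_fubini_tonelli_F F mF F0).
- by move=> x; exact: integral_ge0.
transitivity (\int[m]_x \int[m2]_y (F (x, y) * (k x)%:E))%E.
  apply: eq_integral => x _; rewrite ge0_integralZr ?lee_fin//.
  exact: (measurable_fun_pair2 x mF).
rewrite (fubini_tonelli (fun u => F u * (k u.1)%:E)%E)//; last first.
  by move=> u; rewrite mule_ge0 ?lee_fin.
apply: eq_integral => y _; rewrite nu_k//.
exact: (measurable_fun_pair1 y mF).
Qed.

(** Lets the product of two sigma-finite measures serve in turn as a factor of a
    product, as [density_tonelli] needs for Lebesgue measure on [R^n * R]. *)
Lemma product_sigma_finite d1 d2 (T1 : measurableType d1)
    (T2 : measurableType d2) (R : realType)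
    (m1 : {sigma_finite_measure set T1 -> \bar R})
    (m2 : {sigma_finite_measure set T2 -> \bar R}) :
  exists m : {sigma_finite_measure set (T1 * T2)%type -> \bar R},
    m = (m1 \x m2)%E :> (set _ -> \bar R).
Proof.
pose M : {measure set (T1 * T2)%type -> \bar R} := (m1 \x m2)%E.
have [F UF Ffin] := sigma_finiteT m1; have [G UG Gfin] := sigma_finiteT m2.
have sfM : sigma_finite setT M.
  exists (fun k => if unpickle k is Some (i, j) then F i `*` G j else set0).
    apply/esym/seteqP; split => // -[x y] _.
    have [i _ Fix] : (\bigcup_k F k) x by rewrite -UF.
    have [j _ Gjy] : (\bigcup_k G k) y by rewrite -UG.
    by exists (pickle (i, j)) => //; rewrite pickleK.
  move=> k; case: unpickle => [[i j]|]; last by rewrite measure0.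
  have [mF Foo] := Ffin i; have [mG Goo] := Gfin j; split.
    exact: measurableX.
  by rewrite /M/= product_measure1E// lte_mul_pinfty// ge0_fin_numE.
pose sfmix := Measure_isSigmaFinite.Build _ _ _ M sfM.
pose m : {sigma_finite_measure set (T1 * T2)%type -> \bar R} :=
  HB.pack (Measure.sort M) (Measure.class M) sfmix.
by exists m.
Qed.

(** * Right translations of Haar measure *)

(** Right multiplication by [(a, b)] in the group law of [G_n]. *)
Definition right_mul (R : realType) n (a : n.-tuple R) (b : R)
    (z : n.-tuple R * R) : n.-tuple R * R :=
  ([tuple tnth z.1 i + z.2 * tnth a i | i < n], z.2 * b).

(** Measurability jointly in the point and in the multiplier, the form in which
    Tonelli needs it when the multiplier runs along a curve. *)
Lemma measurable_right_mul (R : realType) n :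
  measurable_fun setT (fun u : (n.-tuple R * R) * (n.-tuple R * R) =>
    right_mul u.2.1 u.2.2 u.1).
Proof.
have mt d (T : measurableType d) (g : T -> n.-tuple R) i :
    measurable_fun setT g -> measurable_fun setT (fun u => tnth (g u) i).
  by move=> mg; apply: (measurableT_comp (measurable_tnth i)).
apply: measurable_fun_pair => /=.
  apply/measurable_fun_tnthP => i.
  rewrite (_ : _ \o _ = fun u : (n.-tuple R * R) * (n.-tuple R * R) =>
      tnth u.1.1 i + u.1.2 * tnth u.2.1 i); last first.
    by apply/funext => u /=; rewrite tnth_mktuple.
  apply: measurable_funD; first by apply: mt; exact: measurableT_comp.
  apply: measurable_funM; first exact: measurableT_comp.
  by apply: mt; exact: measurableT_comp.
by apply: measurable_funM; exact: measurableT_comp.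
Qed.

(** For fixed [y] the map translates [x] by [y * a], which changes nothing, and
    the substitution [y * b] in the last variable costs [b^-1]. *)
Lemma ge0_integral_right_mul (R : realType) n (a : n.-tuple R) (b : R)
    (k : n.-tuple R * R -> \bar R) :
  (0 < b)%R -> measurable_fun setT k -> (forall z, 0 <= k z)%E ->
  (\int[lebesgue_tuple R n \x lebesgueR R]_z k (right_mul a b z) =
   b^-1%:E * \int[lebesgue_tuple R n \x lebesgueR R]_z k z)%E.
Proof.
move=> b0 mk k0.
have mkr : measurable_fun setT (k \o right_mul a b).
  apply: (measurableT_comp mk).
  exact: (measurable_fun_pair1 (a, b) (@measurable_right_mul R n)).
rewrite (fubini_tonelli2 (k \o right_mul a b))//; last by move=> z; exact: k0.
rewrite (fubini_tonelli2 k)//.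
pose K y := (\int[lebesgue_tuple R n]_x k (x, y))%E.
transitivity (\int[lebesgueR R]_y K (b * y + 0)%R)%E.
  apply: eq_integral => y _; rewrite /fubini_G /K addr0.
  rewrite -(ge0_integral_translate [tuple y * tnth a i | i < n]
      (g := fun x => k (x, b * y)))//.
    apply: eq_integral => x _ /=; rewrite /right_mul/= mulrC; congr (k (_, _)).
    by apply: eq_from_tnth => i; rewrite !tnth_mktuple.
  exact: (measurable_fun_pair1 (b * y) mk).
rewrite ge0_integral_affine//.
  exact: (measurable_fun_fubini_tonelli_G k mk k0).
by move=> y; exact: integral_ge0.
Qed.

Lemma haar_density_ge0 (R : realType) n (z : n.-tuple R * R) :
  halfspace R n z -> 0 <= z.2 ^- n.+1.
Proof. by move=> z0; rewrite invr_ge0 exprn_ge0// ltW. Qed.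

Lemma ge0_integral_haar (R : realType) n (f : n.-tuple R * R -> \bar R) :
  measurable_fun (halfspace R n) f ->
  (forall z, halfspace R n z -> 0 <= f z)%E ->
  (\int[haar R n]_(z in halfspace R n) f z =
   \int[lebesgue_tuple R n \x lebesgueR R]_(z in halfspace R n)
     (f z * (z.2 ^- n.+1)%:E))%E.
Proof.
move=> mf f0; apply: ge0_integral_density => //.
- exact: measurable_halfspace.
- by apply/measurable_EFinP; exact: measurable_haar_density.
- exact: haar_density_ge0.
Qed.

Lemma halfspace_right_mul (R : realType) n (a : n.-tuple R) (b : R) z :
  0 < b -> halfspace R n (right_mul a b z) <-> halfspace R n z.
Proof. by move=> b0; rewrite /halfspace /= pmulr_lgt0. Qed.

(** The modular function of [G_n]: the weight [y ^- n.+1] gains [b ^+ n.+1] when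
    it is moved to [y * b], and Lebesgue measure loses one factor [b]. *)
Lemma ge0_integral_haar_right_mul (R : realType) n (a : n.-tuple R) (b : R)
    (f : n.-tuple R * R -> \bar R) :
  (0 < b)%R -> measurable_fun setT f -> (forall z, 0 <= f z)%E ->
  (\int[haar R n]_(z in halfspace R n) f (right_mul a b z) =
   (b ^+ n)%:E * \int[haar R n]_(z in halfspace R n) f z)%E.
Proof.
move=> b0 mf f0.
have mfr : measurable_fun setT (f \o right_mul a b).
  apply: (measurableT_comp mf).
  exact: (measurable_fun_pair1 (a, b) (@measurable_right_mul R n)).
rewrite ge0_integral_haar//; last exact: measurable_funTS.
rewrite ge0_integral_haar//; last exact: measurable_funTS.
have hs0 := @measurable_halfspace R n.
pose k := ((fun z => f z * (z.2 ^- n.+1)%:E)%E \_ (halfspace R n)).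
have mk : measurable_fun setT k.
  apply/(measurable_restrictT _ hs0); apply: emeasurable_funM.
    exact: measurable_funTS.
  exact: measurable_haar_density.
have k0 z : (0 <= k z)%E.
  rewrite /k patchE; case: ifPn => // /[!inE] z0.
  by rewrite mule_ge0// lee_fin haar_density_ge0.
rewrite [in RHS]integral_mkcond -/k.
transitivity (\int[lebesgue_tuple R n \x lebesgueR R]_z
   ((b ^+ n.+1)%:E * k (right_mul a b z)))%E.
  rewrite integral_mkcond; apply: eq_integral => z _.
  rewrite /k !patchE; case: ifPn => zh; last first.
    rewrite ifN ?mule0//; apply: contra zh.
    by rewrite !inE => /halfspace_right_mul; exact.
  rewrite ifT; last by move: zh; rewrite !inE => zh; exact/halfspace_right_mul.
  rewrite muleCA -EFinM; congr (_ * _%:E)%E => /=.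
  by rewrite exprMn invfM mulrCA mulfV ?mulr1// expf_neq0// gt_eqF.
rewrite ge0_integralZl//; last 2 first.
- apply: (measurableT_comp mk).
  exact: (measurable_fun_pair1 (a, b) (@measurable_right_mul R n)).
- by rewrite lee_fin exprn_ge0// ltW.
rewrite ge0_integral_right_mul// muleA -EFinM; congr (_%:E * _)%E.
by rewrite exprSr mulfK// gt_eqF.
Qed.

Lemma haar_tonelli (R : realType) n
    (F : (n.-tuple R * R) * R -> \bar R) :
  measurable_fun setT F -> (forall u, 0 <= F u)%E ->
  (\int[haar R n]_(z in halfspace R n) \int[lebesgueR R]_t F (z, t) =
   \int[lebesgueR R]_t \int[haar R n]_(z in halfspace R n) F (z, t))%E.
Proof.
move=> mF F0.
have [m mE] := product_sigma_finite (lebesgue_tuple R n) (lebesgueR R).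
apply: (@density_tonelli _ _ _ _ _ m _ _ _
  (fun z => z.2 ^- n.+1)) => //.
- exact: measurable_halfspace.
- by apply/measurable_EFinP; exact: measurable_haar_density.
- exact: haar_density_ge0.
- by move=> A _; rewrite mE.
Qed.

(** * The hyperbolic curve *)

Lemma expRDexpRN_gt0 (R : realType) (t : R) : 0 < expR t + expR (- t).
Proof. by rewrite addr_gt0 ?expR_gt0. Qed.

Lemma sech_gt0 (R : realType) (t : R) : 0 < sech t.
Proof. by rewrite divr_gt0 ?expRDexpRN_gt0. Qed.

Lemma sech_le_expRN (R : realType) (t : R) : sech t <= 2 * expR (- t).
Proof.
rewrite /sech ler_wpM2l// -[leLHS]mul1r ler_pdivrMr ?expRDexpRN_gt0//.
by rewrite mulrDr -expRD addNr expR0 lerDl mulr_ge0 ?expR_ge0.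
Qed.

Lemma sech_le1 (R : realType) (t : R) : sech t <= 1.
Proof.
rewrite ler_pdivrMr ?expRDexpRN_gt0// mul1r.
have := expR_ge1Dx t; have := expR_ge1Dx (- t); lra.
Qed.

Lemma measurable_expRDexpRNV (R : realType) :
  measurable_fun setT (fun t : R => (expR t + expR (- t))^-1).
Proof.
apply: continuous_measurable_fun => t.
apply: cvgV; first by rewrite gt_eqF ?expRDexpRN_gt0.
apply: cvgD; first exact: continuous_expR.
by apply: continuous_comp; [exact: opp_continuous|exact: continuous_expR].
Qed.

Lemma measurable_sech (R : realType) : measurable_fun setT (@sech R).
Proof. by apply: measurable_funM => //; exact: measurable_expRDexpRNV. Qed.

Lemma measurable_tanh (R : realType) : measurable_fun setT (@tanh R).
Proof.
apply: measurable_funM; last exact: measurable_expRDexpRNV.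
by apply: measurable_funB => //; exact: measurableT_comp.
Qed.

(** Since [sech t <= 1] and [1 <= n], the power is at most [sech t], which is at
    most twice the exponential density of rate [1]; for [n = 0] the integral
    would diverge. *)
Lemma integral_sech_le2 (R : realType) n : (0 < n)%N ->
  (\int[lebesgueR R]_(t in `[0%R, +oo[) (sech t ^+ n)%:E <= 2%:E)%E.
Proof.
move=> n0.
have mE : measurable_fun setT (fun t : R => (exponential_pdf 1 t)%:E).
  by apply/measurable_EFinP; exact: measurable_exponential_pdf.
have E0 (t : R) : (0 <= (exponential_pdf 1 t)%:E)%E.
  by rewrite lee_fin exponential_pdf_ge0.
apply: (@le_trans _ _
  (\int[lebesgueR R]_(t in `[0%R, +oo[) (2%:E * (exponential_pdf 1 t)%:E))%E).
  apply: ge0_le_integral => //.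
  - by move=> t _; rewrite lee_fin exprn_ge0// ltW// sech_gt0.
  - apply/measurable_EFinP/measurable_funTS/measurable_funX.
    exact: measurable_sech.
  - by apply: measurable_funTS; apply: emeasurable_funM.
  - move=> t; rewrite /= in_itv/= andbT => t0.
    rewrite -EFinM lee_fin exponential_pdfE// mul1r mulN1r.
    apply: le_trans (sech_le_expRN t).
    rewrite -[leRHS]expr1 ler_wiXn2l// ?sech_le1// ltW// sech_gt0//.
rewrite ge0_integralZl//; last exact: measurable_funTS.
rewrite -[leRHS]mule1 lee_pmul2l//.
rewrite -(@integral_exponential_pdf R 1 ltr01) ge0_integral_lebesgueR//.
exact: ge0_subset_integral.
Qed.

(** The path is the right translate of the curve [(w tanh t, sech t)] by the
    point [z]; this is what makes the modular function appear. *)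
Lemma gamma_pathE (R : realType) n (w : n.-tuple R) z t :
  gamma_path w z t = right_mul [tuple tnth w i * tanh t | i < n] (sech t) z.
Proof.
rewrite /gamma_path /right_mul; congr (_, _).
by apply: eq_from_tnth => i; rewrite !tnth_mktuple mulrA.
Qed.

Lemma measurable_gamma_path (R : realType) n (w : n.-tuple R) :
  measurable_fun setT
    (fun u : (n.-tuple R * R) * R => gamma_path w u.1 u.2).
Proof.
rewrite (_ : (fun _ => _) = (fun v : (n.-tuple R * R) * (n.-tuple R * R) =>
    right_mul v.2.1 v.2.2 v.1) \o
    (fun u : (n.-tuple R * R) * R =>
      (u.1, ([tuple tnth w i * tanh u.2 | i < n], sech u.2)))); last first.
  by apply/funext => u /=; rewrite gamma_pathE.
apply: (measurableT_comp (@measurable_right_mul R n)).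
apply: measurable_fun_pair => //; apply: measurable_fun_pair.
  apply/measurable_fun_tnthP => i.
  rewrite (_ : _ \o _ = fun u => tnth w i * tanh u.2); last first.
    by apply/funext => u /=; rewrite tnth_mktuple.
  apply: measurable_funM => //.
  by apply: (measurableT_comp (@measurable_tanh R)).
by apply: (measurableT_comp (@measurable_sech R)).
Qed.

(** * Suprema of averages *)

(** An enumeration of the rationals that are at least [1]; every other index is
    sent to [1]. *)
Definition rat_ge1 (R : realType) (k : nat) : R :=
  Num.max 1 (ratr (odflt 0 (unpickle k))).

Lemma rat_ge1_ge1 (R : realType) k : 1 <= rat_ge1 R k.
Proof. by rewrite le_max lexx. Qed.

(** The averages of a nondecreasing [F] over [r >= 1] need not be monotone in
    [r], but [F r <= F q <= q * S] for every rational [q] above [r], where [S]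
    is the supremum over the rationals, and [q] may tend to [r]. This makes the
    tail maximal function a supremum of countably many functions. *)
Lemma ereal_sup_ge1_esups (R : realType) (F : R -> \bar R) :
  (forall r, 0 <= F r)%E -> {homo F : r s / r <= s >-> (r <= s)%E} ->
  ereal_sup [set ((r^-1)%:E * F r)%E | r in [set r : R | 1 <= r]] =
  esups (fun k => (rat_ge1 R k)^-1%:E * F (rat_ge1 R k))%E 0%N.
Proof.
move=> F0 Fnd; apply/eqP; rewrite eq_le; apply/andP; split; last first.
  apply: le_ereal_sup => _ [k _ <-].
  by exists (rat_ge1 R k) => //=; exact: rat_ge1_ge1.
set S := esups _ _.
have S_ub k : ((rat_ge1 R k)^-1%:E * F (rat_ge1 R k) <= S)%E.
  by apply: ereal_sup_ubound; exists k.
have FS q : 1 <= ratr q :> R -> (F (ratr q) <= (ratr q)%:E * S)%E.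
  move=> q1; have := S_ub (pickle q).
  rewrite /rat_ge1 pickleK/= (max_idPr q1).
  rewrite -lee_pdivrMl ?(lt_le_trans _ q1)//.
have S0 : (0 <= S)%E.
  apply: le_trans (S_ub 0%N).
  by rewrite mule_ge0// lee_fin invr_ge0 (le_trans _ (rat_ge1_ge1 R 0)).
apply: ge_ereal_sup => _ [r /= r1 <-].
have r0 : 0 < r by exact: lt_le_trans r1.
rewrite muleC lee_pdivrMr//.
move: S0 FS {S_ub}; case: S => [s|_ _|//]; last first.
  by rewrite gt0_mulye ?lte_fin// leey.
rewrite lee_fin => s0 FS.
apply/lee_addgt0Pr => e e0.
(* [s + 1] instead of [s] keeps the denominator positive when [s = 0]. *)
have s1 : 0 < s + 1 by rewrite ltr_wpDl.
have re : r < r + e / (s + 1) by rewrite ltrDl divr_gt0.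
have [q] := rat_in_itvoo re.
rewrite in_itv/= => /andP[rq qre].
apply: le_trans (Fnd _ _ (ltW rq)) _.
apply: le_trans (FS q (le_trans r1 (ltW rq))) _.
rewrite -!EFinM -EFinD lee_fin.
apply: (@le_trans _ _ ((r + e / (s + 1)) * s)).
  by rewrite ler_wpM2r// ltW.
rewrite mulrDl (mulrC s) lerD2l -mulrA ger_pMr// ler_pdivrMl// mulr1.
by rewrite lerDl.
Qed.

(** * The tail maximal function *)

Section path.
Context (R : realType) (n : nat) (w : n.-tuple R).
Variable f : n.-tuple R * R -> \bar R.
Hypothesis mf : measurable_fun (halfspace R n) f.

(** [f] is only known to be measurable on [G_n]; cutting it off outside makes
    the function measurable jointly in [(z, t)] on the whole space, and costs
    nothing because the path of a point of [G_n] stays in [G_n]. *)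
Definition abs_on_path (u : (n.-tuple R * R) * R) : \bar R :=
  ((abse \o f) \_ (halfspace R n)) (gamma_path w u.1 u.2).

Lemma abs_on_path_ge0 u : (0 <= abs_on_path u)%E.
Proof. by rewrite /abs_on_path patchE; case: ifP => // _; exact: abse_ge0. Qed.

Lemma measurable_abse_halfspace :
  measurable_fun setT ((abse \o f) \_ (halfspace R n)).
Proof.
apply/(measurable_restrictT _ (@measurable_halfspace R n)).
exact: measurableT_comp.
Qed.

Lemma measurable_abs_on_path : measurable_fun setT abs_on_path.
Proof.
apply: (measurableT_comp measurable_abse_halfspace).
exact: measurable_gamma_path.
Qed.

Lemma abs_on_pathE z t : halfspace R n z ->
  abs_on_path (z, t) = `|f (gamma_path w z t)|%E.
Proof.
move=> z0; rewrite /abs_on_path patchE ifT// inE gamma_pathE.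
by apply/halfspace_right_mul => //; exact: sech_gt0.
Qed.

Definition path_integral (D : set R) z :=
  (\int[lebesgueR R]_(t in D) abs_on_path (z, t))%E.

Lemma measurable_path_integral D : measurable D ->
  measurable_fun setT (path_integral D).
Proof.
move=> mD.
have mDT : measurable ([set: n.-tuple R * R] `*` D) by exact: measurableX.
rewrite (_ : path_integral D =
    fubini_F (lebesgueR R)
      (abs_on_path \_ ([set: n.-tuple R * R] `*` D))); last first.
  apply/funext => z; rewrite /path_integral integral_mkcond.
  apply: eq_integral => t _.
  by rewrite !patchE in_setX in_setT.
apply: measurable_fun_fubini_tonelli_F.
  apply/(measurable_restrictT _ mDT); apply: measurable_funTS.
  exact: measurable_abs_on_path.
by move=> u; rewrite patchE; case: ifP => // _; exact: abs_on_path_ge0.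
Qed.

Lemma path_integral_ge0 D z : (0 <= path_integral D z)%E.
Proof. by apply: integral_ge0 => t _; exact: abs_on_path_ge0. Qed.

Lemma path_integral_subset (D E : set R) z : measurable D -> measurable E ->
  D `<=` E -> (path_integral D z <= path_integral E z)%E.
Proof.
move=> mD mE DE; apply: ge0_subset_integral => //.
  apply: measurable_funTS.
  exact: (measurable_fun_pair2 z measurable_abs_on_path).
by move=> t _; exact: abs_on_path_ge0.
Qed.

Lemma tail_maximalE z : halfspace R n z -> tail_maximal w f z =
  ereal_sup [set ((r^-1)%:E * path_integral `[0%R, r] z)%E
            | r in [set r : R | 1 <= r]].
Proof.
move=> z0; rewrite /tail_maximal; congr ereal_sup.
apply: eq_imagel => r _; congr (_ * _)%E.
rewrite /path_integral -ge0_integral_lebesgueR//.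
- by apply: eq_integral => t _; rewrite abs_on_pathE.
- apply: measurable_funTS.
  exact: (measurable_fun_pair2 z measurable_abs_on_path).
- by move=> t _; exact: abs_on_path_ge0.
Qed.

Lemma measurable_tail_maximal :
  measurable_fun (halfspace R n) (tail_maximal w f).
Proof.
pose h k z := ((rat_ge1 R k)^-1%:E * path_integral `[0%R, rat_ge1 R k] z)%E.
apply: (@eq_measurable_fun _ _ _ _ _ (fun z => esups (h ^~ z) 0%N)).
  move=> z; rewrite inE => z0; rewrite tail_maximalE//.
  rewrite (ereal_sup_ge1_esups (F := fun r => path_integral `[0%R, r] z))//.
    by move=> r; exact: path_integral_ge0.
  move=> r s rs; apply: path_integral_subset => //.
  by apply: subset_itvl; rewrite bnd_simp.
apply: measurable_fun_esups => k; apply: measurable_funTS.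
by apply: measurable_funeM; exact: measurable_path_integral.
Qed.

Lemma tail_maximal_ge0 z : halfspace R n z -> (0 <= tail_maximal w f z)%E.
Proof.
move=> z0; rewrite tail_maximalE//.
apply: (@le_trans _ _ ((1%R^-1)%:E * path_integral `[0%R, 1%R] z)%E).
  by rewrite invr1 mul1e path_integral_ge0.
by apply: ereal_sup_ubound; exists 1 => /=.
Qed.

(** The restriction [r >= 1] is used here: the factor [r^-1] is at most [1], so
    every average is at most the integral over the whole half-line. *)
Lemma tail_maximal_le z : halfspace R n z ->
  (tail_maximal w f z <= path_integral `[0%R, +oo[ z)%E.
Proof.
move=> z0; rewrite tail_maximalE//; apply: ge_ereal_sup => _ [r /= r1 <-].
apply: (@le_trans _ _ (path_integral `[0%R, r] z)).
  rewrite -[leRHS]mul1e lee_wpmul2r ?path_integral_ge0// lee_fin.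
  by rewrite invf_le1 ?(lt_le_trans _ r1).
by apply: path_integral_subset => //; apply: subset_itvl.
Qed.

(** Tonelli puts the integral in [z] inside, where right multiplication by
    the point of the curve at time [t] yields the factor [sech t ^+ n]. *)
Lemma integral_haar_path_integral : (0 < n)%N ->
  (\int[haar R n]_(z in halfspace R n) path_integral `[0%R, +oo[ z <=
   2%:E * \int[haar R n]_(z in halfspace R n) `|f z|)%E.
Proof.
move=> n0; pose D := `[0%R, +oo[%classic : set R.
have mD : measurable D by exact: measurable_itv.
have mDT : measurable ([set: n.-tuple R * R] `*` D) by exact: measurableX.
pose F := abs_on_path \_ ([set: n.-tuple R * R] `*` D).
have mF : measurable_fun setT F.
  apply/(measurable_restrictT _ mDT); apply: measurable_funTS.
  exact: measurable_abs_on_path.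
have F0 u : (0 <= F u)%E.
  by rewrite /F patchE; case: ifP => // _; exact: abs_on_path_ge0.
set I := (\int[haar R n]_(z in halfspace R n) `|f z|)%E.
have I0 : (0 <= I)%E by exact: integral_ge0.
have -> : (\int[haar R n]_(z in halfspace R n) path_integral D z =
    \int[haar R n]_(z in halfspace R n) \int[lebesgueR R]_t F (z, t))%E.
  apply: eq_integral => z _; rewrite /path_integral integral_mkcond.
  by apply: eq_integral => t _; rewrite /F !patchE in_setX in_setT.
rewrite haar_tonelli//.
have -> : (\int[lebesgueR R]_t \int[haar R n]_(z in halfspace R n) F (z, t) =
    \int[lebesgueR R]_(t in D) ((sech t ^+ n)%:E * I))%E.
  rewrite [RHS]integral_mkcond; apply: eq_integral => t _.
  rewrite patchE; case: ifPn => tD; last first.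
    by apply: integral0_eq => z _; rewrite /F patchE in_setX in_setT (negbTE tD).
  rewrite (_ : I = \int[haar R n]_(z in halfspace R n)
      ((abse \o f) \_ (halfspace R n)) z)%E; last first.
    by apply: eq_integral => z zh; rewrite patchE zh.
  rewrite -(ge0_integral_haar_right_mul [tuple tnth w i * tanh t | i < n])//.
  - apply: eq_integral => z _.
    by rewrite /F patchE in_setX in_setT tD /abs_on_path gamma_pathE.
  - exact: sech_gt0.
  - exact: measurable_abse_halfspace.
  - by move=> z; rewrite patchE; case: ifP => // _; exact: abse_ge0.
rewrite ge0_integralZr//; last 2 first.
- apply/measurable_EFinP/measurable_funTS/measurable_funX.
  exact: measurable_sech.
- by move=> t _; rewrite lee_fin exprn_ge0// ltW// sech_gt0.
by rewrite lee_wpmul2r// integral_sech_le2.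
Qed.

End path.

(** Markov's inequality at each height [l], stated for [l <= |g|] and hence
    available for the smaller set where [l < |g|]. *)
Lemma weak_L1_norm_le d (T : measurableType d) (R : realType)
    (mu : {measure set T -> \bar R}) (D : set T) (g : T -> \bar R) :
  measurable D -> measurable_fun D g ->
  (weak_L1_norm mu D g <= \int[mu]_(z in D) `|g z|)%E.
Proof.
move=> mD mg; apply: ge_ereal_sup => _ [l /= l0 <-].
have mag : measurable_fun D (abse \o g) by exact: measurableT_comp.
have := @le_integral_comp_abse _ _ _ mu D mD g l id (@measurable_id _ _ setT).
move=> /(_ (fun _ => id) (fun _ _ _ _ => id) mg l0); apply: le_trans.
rewrite lee_pmul2l// le_measure// ?inE.
- exact: emeasurable_fun_o_infty.
- exact: emeasurable_fun_c_infty.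
- by move=> z [Dz /ltW].
Qed.

Theorem proposition20 (R : realType) (n : nat) (hn : (1 <= n)%N) :
  exists C : R, forall (w : n.-tuple R) (f : n.-tuple R * R -> \bar R),
    unit_sphere R n w ->
    (haar R n).-integrable (halfspace R n) f ->
    [/\ measurable_fun (halfspace R n) (tail_maximal w f),
        (\int[haar R n]_(z in halfspace R n) `|tail_maximal w f z|
          <= C%:E * \int[haar R n]_(z in halfspace R n) `|f z|)%E &
        (weak_L1_norm (haar R n) (halfspace R n) (tail_maximal w f)
          <= C%:E * \int[haar R n]_(z in halfspace R n) `|f z|)%E].
Proof.
exists 2 => w f _ /integrableP[mf _].
have mM := measurable_tail_maximal w mf.
have mhs := @measurable_halfspace R n.
have L1 : (\int[haar R n]_(z in halfspace R n) `|tail_maximal w f z|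
    <= 2%:E * \int[haar R n]_(z in halfspace R n) `|f z|)%E.
  apply: le_trans (integral_haar_path_integral w mf hn).
  apply: ge0_le_integral => //.
  - exact: measurableT_comp.
  - by apply: measurable_funTS; exact: measurable_path_integral.
  - move=> z z0; rewrite gee0_abs; last exact: tail_maximal_ge0.
    exact: tail_maximal_le.
by split => //; apply: le_trans L1; exact: weak_L1_norm_le.
Qed.
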